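(* Let $d\ge 1$. For each integer $q$ with $0\le q\le d-1$ and for each $\mu=(\mu_0,\ldots,\mu_{2d-1})\in\mathbb{R}^{2d}$ the variety $S_q(\mu)$ satisfies the following conditions: 1. $S_q(\mu)$ is non-empty, its dimension is equal to $2d-q-1$, and the equations $\sum_{j=1}^d a_jx_j^k=\mu_k$, $k=0,\ldots,q$, are regular at each point $P$ of $S_q(\mu)$, i.e. the rank of their Jacobian (with respect to $(a,x)$) at $P$ is $q+1$. 2. The nodes $x_1,\ldots,x_d$ and any $d-q-1$ of the amplitudes (in particular, $a_{q+2},\ldots,a_d$) form a global regular coordinate system on $S_q(\mu)$. 3. The projection $p_x:S_q(\mu)\to\mathcal{P}^x_d$ is onto. It defines $S_q(\mu)$ as a trivial affine bundle over $\mathcal{P}^x_d$, naturally isomorphic to $\mathbb{R}^{d-q-1}\times\mathcal{P}^x_d$. In particular, $S_q(\mu)$ is topologically trivial.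
   Context: Let $\mathcal{P}^x_d=\{(x_1,\ldots,x_d)\in\mathbb{R}^d : x_1<x_2<\cdots<x_d\}$ (the space of nodes), $\mathcal{P}^a_d=\mathbb{R}^d$ (the space of amplitudes $a=(a_1,\ldots,a_d)$), and $\mathcal{P}_d=\mathcal{P}^a_d\times\mathcal{P}^x_d$, an open subset of $\mathbb{R}^{2d}$. For $\mu\in\mathbb{R}^{2d}$ and $0\le q\le 2d-1$, the Prony variety is $$S_q(\mu)=\Big\{(a,x)\in\mathcal{P}_d : \sum_{j=1}^d a_jx_j^k=\mu_k,\ k=0,1,\ldots,q\Big\}.$$ The map $p_x$ is $p_x(a,x)=x$. Each fiber of $p_x$ on $S_q(\mu)$ is an affine subspace of the amplitude space $\mathbb{R}^d$, and ''affine bundle'' refers to this structure: an isomorphism with $\mathbb{R}^{d-q-1}\times\mathcal{P}^x_d$ is a diffeomorphism commuting with the projections to $\mathcal{P}^x_d$ and affine on fibers. ''Global regular coordinate system'' means that the indicated functions together define a diffeomorphism of $S_q(\mu)$ onto $\mathcal{P}^x_d\times\mathbb{R}^{d-q-1}$. *)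

(* Defs.v *)
From mathcomp Require Import all_boot all_order all_algebra.
From mathcomp Require Import all_classical all_reals all_analysis.
Set Implicit Arguments.
Unset Strict Implicit.
Unset Printing Implicit Defensive.
Import Order.TTheory GRing.Theory Num.Theory.
Import numFieldNormedType.Exports.
Local Open Scope classical_set_scope.
Local Open Scope ring_scope.

(* Smooth maps between arbitrary subsets of Euclidean spaces follow the usual
   convention (Milnor, "Topology from the differentiable viewpoint"): a map on a
   subset is smooth when it extends, around each point of the subset, to a
   C^infinity map on an open set of the ambient space. *)
Section Smooth.
Variable R : realType.

(* Since the source is finite-dimensional, f is C^(r+1) on an open set iff it is
   differentiable there and all its directional derivatives are C^r. *)
Fixpoint Cr_on n m (r : nat) (U : set 'rV[R]_n) (f : 'rV[R]_n -> 'rV[R]_m) :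
    Prop :=
  match r with
  | 0%N => forall p, U p -> {for p, continuous f}
  | r'.+1 => (forall p, U p -> differentiable f p) /\
             (forall v, Cr_on r' U ('D_v f))
  end.

Definition smooth_on n m (X : set 'rV[R]_n) (f : 'rV[R]_n -> 'rV[R]_m) : Prop :=
  forall p, X p -> exists (U : set 'rV[R]_n) (g : 'rV[R]_n -> 'rV[R]_m),
    [/\ open U, U p, forall r, Cr_on r U g & {in U `&` X, g =1 f}].

Definition diffeomorphism n m (X : set 'rV[R]_n) (Y : set 'rV[R]_m)
    (f : 'rV[R]_n -> 'rV[R]_m) : Prop :=
  [/\ set_bij X Y f, smooth_on X f
    & exists2 g : 'rV[R]_m -> 'rV[R]_n, {in X, cancel f g} & smooth_on Y g].

Definition submanifold n (k : nat) (X : set 'rV[R]_n) : Prop :=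
  forall p, X p ->
    exists (W : set 'rV[R]_n) (U : set 'rV[R]_k) (f : 'rV[R]_n -> 'rV[R]_k),
      [/\ open W, W p, open U & diffeomorphism (X `&` W) U f].

(* The library's matrix of the differential acts on row vectors: it is the
   transpose of the usual Jacobian, with the same rank. *)
Definition regular_at n m (F : 'rV[R]_n -> 'rV[R]_m) (p : 'rV[R]_n) : Prop :=
  differentiable F p /\ \rank ('J F p) = m.

Definition contractible n (X : set 'rV[R]_n) : Prop :=
  exists (c : 'rV[R]_n) (H : R * 'rV[R]_n -> 'rV[R]_n),
    [/\ X c,
        {within `[0, 1]%classic `*` X, continuous H},
        set_fun (`[0, 1]%classic `*` X) X H,
        forall p, X p -> H (0, p) = p
      & forall p, X p -> H (1, p) = c].

Definition affine_subspace n (k : nat) (A : set 'rV[R]_n) : Prop :=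
  exists (a0 : 'rV[R]_n) (L : 'M[R]_n),
    \rank L = k /\ A = [set a | (a - a0 <= L)%MS].

End Smooth.

Section Prony.
Variables (R : realType) (d : nat).

Definition node_space : set 'rV[R]_d :=
  [set x | forall i j : 'I_d, (i < j)%N -> x 0 i < x 0 j].

(* A point (a, x) of R^d x R^d is the row vector [row_mx a x] of R^(d + d). *)
Definition amps (p : 'rV[R]_(d + d)) : 'rV[R]_d := lsubmx p.
Definition nodes (p : 'rV[R]_(d + d)) : 'rV[R]_d := rsubmx p.

Definition moment (k : nat) (p : 'rV[R]_(d + d)) : R :=
  \sum_(j < d) amps p 0 j * nodes p 0 j ^+ k.

Definition moment_map (q : nat) (p : 'rV[R]_(d + d)) : 'rV[R]_q.+1 :=
  \row_(k < q.+1) moment k p.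

Definition prony_variety (q : nat) (mu : 'rV[R]_(2 * d)) :
    set 'rV[R]_(d + d) :=
  [set p | node_space (nodes p) /\
           forall k : 'I_(2 * d), (k <= q)%N -> moment k p = mu 0 k].

Definition select_amps k (s : 'I_k -> 'I_d) (p : 'rV[R]_(d + d)) : 'rV[R]_k :=
  \row_j amps p 0 (s j).

Definition global_coordinates k (s : 'I_k -> 'I_d)
    (E : set 'rV[R]_(d + d)) : Prop :=
  diffeomorphism E [set y : 'rV[R]_(d + k) | node_space (lsubmx y)]
    (fun p => row_mx (nodes p) (select_amps s p)).

Definition fiber (E : set 'rV[R]_(d + d)) (x : 'rV[R]_d) : set 'rV[R]_d :=
  [set a | E (row_mx a x)].

(* [phi] identifies E with R^k x node_space over node_space, affinely on the
   fibers; points of R^k x node_space are written [row_mx w x]. *)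
Definition affine_trivialization k (E : set 'rV[R]_(d + d))
    (phi : 'rV[R]_(d + d) -> 'rV[R]_(k + d)) : Prop :=
  [/\ diffeomorphism E [set y : 'rV[R]_(k + d) | node_space (rsubmx y)] phi,
      forall p, E p -> rsubmx (phi p) = nodes p
    & forall x, node_space x -> forall a b, fiber E x a -> fiber E x b ->
      forall t : R,
        lsubmx (phi (row_mx ((1 - t) *: a + t *: b) x)) =
        (1 - t) *: lsubmx (phi (row_mx a x)) + t *: lsubmx (phi (row_mx b x))].

Lemma last_amp_subproof q (j : 'I_(d - q - 1)) : (q.+1 + j < d)%N.
Proof. by case: j => j /=; rewrite -subnDA addn1 ltn_subRL. Qed.

(* With 0-based indices, q+1, ..., d-1 stand for the amplitudes
   a_(q+2), ..., a_d. *)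
Definition last_amp q (j : 'I_(d - q - 1)) : 'I_d :=
  Ordinal (last_amp_subproof j).

End Prony.

(* Main.v *)
Require Import Defs.
From mathcomp Require Import all_boot all_order all_algebra.
From mathcomp Require Import all_classical all_reals all_analysis.
From mathcomp Require Import zify.
Import Order.TTheory GRing.Theory Num.Theory.
Import numFieldNormedType.Exports.
Local Open Scope classical_set_scope.
Local Open Scope ring_scope.

(** For fixed nodes x the moment equations are linear in the amplitudes a: they
    read a *m V(x) = c, where V(x) is the d x (q+1) matrix of the powers x_i^l.
    Prescribing in addition d-q-1 amplitudes a_(s j), for an injective s, gives
    a square linear system. It is nonsingular when the nodes are distinct: if a
    solves the homogeneous system, then a_(s j) = 0 and the sum of the
    a_i P(x_i) vanishes for every polynomial P of degree at most q; taking for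
    P the product of the X - x_l over the q free indices l other than a given
    free index i isolates a_i ([system_inj]). Cramer's rule therefore expresses
    all the amplitudes as rational functions of the nodes and the d-q-1 chosen
    amplitudes ([amplitude_solver]), with a denominator that vanishes nowhere
    on the node space.

    So the linear map (a, x) |-> (x, (a_(s j))_j) has on the variety a global
    inverse which is rational, hence smooth ([variety_chart]). Everything
    follows: the manifold structure and the global coordinates are this chart;
    surjectivity onto the node space and the trivial affine bundle are the same
    chart with its two blocks exchanged; and the variety is contractible because
    the chart identifies it with a convex set
    ([contractible_convex_chart]). Since V(x) has full rank q+1
    ([rank_node_powers]), the fibers are affine of dimension d-q-1, and the
    Jacobian of the moment map, which contains V(x) as the block of derivatives
    along the amplitudes, has rank q+1 ([moment_map_regular]).

    Smoothness is obtained from the class [rational_on] of functions built from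
    constants and coordinates by sums, products and nonvanishing inverses: the
    class is stable under directional derivatives, and its members are
    differentiable, so they are C^r for every r ([rational_smooth]). *)

Set Implicit Arguments.
Unset Strict Implicit.

(** * Rational functions are smooth *)

Lemma near_eq_differentiable (R : numFieldType) (V W : normedModType R)
    (f g : V -> W) (p : V) :
  {near p, f =1 g} -> differentiable f p -> differentiable g p.
Proof.
move=> fg df; have fgp := nbhs_singleton fg.
have [dfc /eqaddoP fo] := (diff_locallyP p f).1 df.
have go : g \o shift p = cst (g p) + 'd f p +o_ 0 id.
  apply/eqaddoP => e e0; have foe := fo e e0.
  have fgS : \forall h \near nbhs_filter_on (0 : V), f (h + p) = g (h + p).
    by move: fg; rewrite (near_shift 0)/= subr0.
  near=> h; have fgh : f (h + p) = g (h + p) by near: h.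
  suff : `|(f \o shift p - (cst (f p) + 'd f p)) h| <= e * `|h|.
    by rewrite !fctE /= fgh fgp.
  by near: h.
apply/diff_locallyP; by rewrite (diff_unique dfc go).
Unshelve. all: by end_near. Qed.

Section RationalFunctions.
Variables (R : realType) (n : nat).
Implicit Types (U : set 'rV[R]_n) (f g : 'rV[R]_n -> R).

(** The functions on R^n given by a rational expression whose denominators do
    not vanish on U. The expression determines the function everywhere, through
    the convention 0^-1 = 0, but only its values on U are meaningful. *)
Inductive rational_on U : ('rV[R]_n -> R) -> Prop :=
| rational_cst c : rational_on U (fun=> c)
| rational_coord j : rational_on U (fun p => p 0 j)
| rational_add f g : rational_on U f -> rational_on U g ->
    rational_on U (fun p => f p + g p)
| rational_mul f g : rational_on U f -> rational_on U g ->
    rational_on U (fun p => f p * g p)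
| rational_inv f : rational_on U f -> (forall p, U p -> f p != 0) ->
    rational_on U (fun p => (f p)^-1).

Lemma rational_sum U (I : Type) (r : seq I) (P : pred I)
    (F : I -> 'rV[R]_n -> R) :
  (forall i, rational_on U (F i)) ->
  rational_on U (fun p => \sum_(i <- r | P i) F i p).
Proof.
move=> ratF; elim: r => [|i r IHr].
  under eq_fun do rewrite big_nil; exact: rational_cst.
under eq_fun do rewrite big_cons.
by case: (P i) => //; apply: rational_add.
Qed.

Lemma rational_prod U (I : Type) (r : seq I) (P : pred I)
    (F : I -> 'rV[R]_n -> R) :
  (forall i, rational_on U (F i)) ->
  rational_on U (fun p => \prod_(i <- r | P i) F i p).
Proof.
move=> ratF; elim: r => [|i r IHr].
  under eq_fun do rewrite big_nil; exact: rational_cst.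
under eq_fun do rewrite big_cons.
by case: (P i) => //; apply: rational_mul.
Qed.

Lemma rational_exp U f k : rational_on U f -> rational_on U (fun p => f p ^+ k).
Proof.
move=> ratf; elim: k => [|k IHk].
  under eq_fun do rewrite expr0; exact: rational_cst.
by under eq_fun do rewrite exprS; apply: rational_mul.
Qed.

Lemma rational_det U m (A : 'rV[R]_n -> 'M[R]_m) :
  (forall i j, rational_on U (fun p => A p i j)) ->
  rational_on U (fun p => \det (A p)).
Proof.
move=> ratA; apply: rational_sum => s.
apply: rational_mul; first exact: rational_cst.
exact: rational_prod.
Qed.

Lemma rational_adj U m (A : 'rV[R]_n -> 'M[R]_m) i j :
  (forall i j, rational_on U (fun p => A p i j)) ->
  rational_on U (fun p => (\adj (A p)) i j).
Proof.
move=> ratA; under eq_fun do rewrite mxE /cofactor.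
apply: rational_mul; first exact: rational_cst.
by apply: rational_det => i' j'; under eq_fun do rewrite !mxE.
Qed.

Lemma rational_differentiable U f :
  rational_on U f -> forall p, U p -> differentiable f p.
Proof.
elim=> {f} [c|j|f g _ IHf _ IHg|f g _ IHf _ IHg|f _ IHf f0] p Up.
- exact: differentiable_cst.
- exact: differentiable_coord.
- exact: (differentiableD (IHf p Up) (IHg p Up)).
- exact: (differentiableM (IHf p Up) (IHg p Up)).
- exact: (differentiableV (IHf p Up) (f0 p Up)).
Qed.

Lemma derive_coord (p v : 'rV[R]_n) j :
  'D_v (fun q : 'rV[R]_n => q 0 j) p = v 0 j.
Proof.
have did : derivable (fun q : 'rV[R]_n => q) p v by exact: derivable_id.
have /(congr1 (fun M : 'rV[R]_n => M 0 j)) := derive_mx did.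
by rewrite mxE derive_id.
Qed.

(** The derivative is rational on U only up to its values off U, where [f] need
    not be differentiable. *)
Lemma rational_derive U f v : rational_on U f ->
  exists2 g, rational_on U g & forall p, U p -> 'D_v f p = g p.
Proof.
have drv h p : rational_on U h -> U p -> derivable h p v.
  by move=> rh Up; exact/diff_derivable/(rational_differentiable rh Up).
move=> ratf; elim: ratf => {f} [c|j|f g rf [df rdf fE] rg [dg rdg gE]
    |f g rf [df rdf fE] rg [dg rdg gE]|f rf [df rdf fE] f0].
- exists (fun=> 0); first exact: rational_cst.
  by move=> p _; rewrite derive_cst.
- exists (fun=> v 0 j); first exact: rational_cst.
  by move=> p _; rewrite derive_coord.
- exists (fun p => df p + dg p); first exact: rational_add.
  move=> p Up; rewrite -fE// -gE//.
  exact: (deriveD (drv _ _ rf Up) (drv _ _ rg Up)).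
- exists (fun p => f p * dg p + g p * df p).
    by apply: rational_add; exact: rational_mul.
  move=> p Up; rewrite -fE// -gE//.
  exact: (deriveM (drv _ _ rf Up) (drv _ _ rg Up)).
- exists (fun p => (- 1) * ((f p)^-1 * (f p)^-1) * df p).
    apply: rational_mul => //; apply: rational_mul; first exact: rational_cst.
    by apply: rational_mul; exact: rational_inv.
  move=> p Up; rewrite (deriveV (f0 p Up) (drv _ _ rf Up)) fE//.
  by rewrite mulN1r -invfM -expr2.
Qed.

Lemma differentiable_row m (F : 'rV[R]_n -> 'rV[R]_m) p :
  (forall j, differentiable (fun q => F q 0 j) p) -> differentiable F p.
Proof.
move=> dF.
rewrite (_ : F = \sum_(j < m) (fun q => F q 0 j *: delta_mx 0 j)).
  by apply: differentiable_sum => j; apply: differentiableZl.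
by apply/funext => q; rewrite fct_sumE; exact: row_sum_delta.
Qed.

(** Coordinates are only required to agree with rational functions on U: this is
    what makes the hypothesis stable under directional derivatives, so that
    the induction on the order of differentiability goes through. *)
Lemma rational_smooth U m (F : 'rV[R]_n -> 'rV[R]_m) : open U ->
  (forall j, exists2 f, rational_on U f & forall p, U p -> F p 0 j = f p) ->
  forall r, Cr_on r U F.
Proof.
move=> oU ratF r.
have dF (G : 'rV[R]_n -> 'rV[R]_m) :
    (forall j, exists2 f, rational_on U f & forall p, U p -> G p 0 j = f p) ->
    forall p, U p -> differentiable G p.
  move=> ratG p Up; apply: differentiable_row => j.
  have [f rf fE] := ratG j.
  apply: near_eq_differentiable (rational_differentiable rf Up).
  by near=> q; apply/esym/fE; near: q; exact: open_nbhs_nbhs.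
elim: r F ratF => [|r IHr] F ratF /=.
  by move=> p Up; apply/differentiable_continuous/dF.
split; first exact: dF.
move=> v; apply: IHr => j.
have [f rf fE] := ratF j; have [df rdf dfE] := rational_derive v rf.
exists df => // p Up.
rewrite derive_mx; last by apply: diff_derivable; exact: dF.
rewrite mxE -dfE//; apply: near_eq_derive.
by near=> q; apply: fE; near: q; exact: open_nbhs_nbhs.
Unshelve. all: by end_near. Qed.

Lemma smooth_on_rational U (X : set 'rV[R]_n) m (F : 'rV[R]_n -> 'rV[R]_m) :
  open U -> X `<=` U -> (forall j, rational_on U (fun p => F p 0 j)) ->
  smooth_on X F.
Proof.
move=> oU XU ratF p Xp; exists U, F; split => //; first exact: XU.
by apply: rational_smooth => // j; exists (fun p => F p 0 j).
Qed.

End RationalFunctions.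

Lemma rational_lsubmx (R : realType) n1 n2 (U : set 'rV[R]_(n1 + n2)) i :
  rational_on U (fun p => (lsubmx p) 0 i).
Proof. by under eq_fun do rewrite mxE; exact: rational_coord. Qed.

Lemma rational_rsubmx (R : realType) n1 n2 (U : set 'rV[R]_(n1 + n2)) i :
  rational_on U (fun p => (rsubmx p) 0 i).
Proof. by under eq_fun do rewrite mxE; exact: rational_coord. Qed.

Lemma rational_row_mx (R : realType) n m1 m2 (U : set 'rV[R]_n)
    (F : 'rV[R]_n -> 'rV[R]_m1) (G : 'rV[R]_n -> 'rV[R]_m2) l :
  (forall i, rational_on U (fun p => F p 0 i)) ->
  (forall i, rational_on U (fun p => G p 0 i)) ->
  rational_on U (fun p => (row_mx (F p) (G p)) 0 l).
Proof.
by move=> rF rG; under eq_fun do rewrite mxE; case: (fintype.split l).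
Qed.

Lemma differentiable_rational (R : realType) n m (F : 'rV[R]_n -> 'rV[R]_m) :
  (forall j, rational_on setT (fun p => F p 0 j)) ->
  forall p, differentiable F p.
Proof.
move=> ratF p; apply: differentiable_row => j.
exact: rational_differentiable (ratF j) p I.
Qed.

(** * The linear system for the amplitudes *)

Section MomentSystem.
Variables (R : realType) (d q : nat).
Implicit Types x a : 'rV[R]_d.

(** The matrix of the powers x_i^l, l <= q, so that [a *m node_powers x] lists
    the moments of order at most q of (a, x). *)
Definition node_powers x : 'M[R]_(d, q.+1) := \matrix_(i, l) x 0 i ^+ l.

Lemma moment_mapE (p : 'rV[R]_(d + d)) :
  moment_map q p = amps p *m node_powers (nodes p).
Proof.
apply/rowP => l; rewrite !mxE /moment; apply: eq_bigr => j _; congr (_ * _).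
by rewrite [RHS]mxE.
Qed.

(** The matrix of the linear system in the amplitudes formed by the coordinates
    selected by [s] and the moments of order at most q. *)
Definition system_mx k (s : 'I_k -> 'I_d) x : 'M[R]_(d, k + q.+1) :=
  row_mx (\matrix_(i, j) (i == s j)%:R) (node_powers x).

Lemma mul_system_mx k (s : 'I_k -> 'I_d) x a :
  a *m system_mx s x = row_mx (\row_j a 0 (s j)) (a *m node_powers x).
Proof.
rewrite mul_mx_row; congr row_mx; apply/rowP => j; rewrite !mxE.
rewrite (bigD1 (s j))//= mxE eqxx mulr1 big1 ?addr0// => i /negPf sji.
by rewrite mxE sji mulr0.
Qed.

(** Vanishing moments up to order q mean that the weights [a] annihilate all
    polynomials of degree at most q at the nodes. *)
Lemma sum_horner_nodes x a (P : {poly R}) :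
  a *m node_powers x = 0 -> (size P <= q.+1)%N ->
  \sum_i a 0 i * P.[x 0 i] = 0.
Proof.
move=> /rowP ax0 sP.
transitivity (\sum_(l < q.+1) P`_l * (a *m node_powers x) 0 l).
  under [RHS]eq_bigr do rewrite mxE mulr_sumr.
  rewrite exchange_big; apply: eq_bigr => i _.
  rewrite (horner_coef_wide _ sP) mulr_sumr; apply: eq_bigr => l _.
  by rewrite !mxE mulrCA.
by apply: big1 => l _; rewrite ax0 mxE mulr0.
Qed.

Lemma node_space_inj x : node_space x -> injective (x 0).
Proof.
move=> xn i j xij; apply/val_inj.
case: (ltngtP (val i) (val j)) => [ij|ji|//].
  by have := xn i j ij; rewrite xij ltxx.
by have := xn j i ji; rewrite xij ltxx.
Qed.

Lemma system_inj k (s : 'I_k -> 'I_d) x a :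
  d = (k + q.+1)%N -> injective s -> node_space x ->
  a *m system_mx s x = 0 -> a = 0.
Proof.
move=> dE sinj /node_space_inj xinj; rewrite mul_system_mx => /eqP.
rewrite row_mx_eq0 => /andP[/eqP/rowP as0 /eqP ax0].
have asj j : a 0 (s j) = 0 by have := as0 j; rewrite !mxE.
apply/rowP => i; rewrite mxE.
have [/codomP[j ->]|iNs] := boolP (i \in codom s); first exact: asj.
pose T := [set l | l \notin codom s]%SET.
have cardT : #|T| = q.+1.
  have := cardsC T; rewrite card_ord.
  rewrite (_ : #|~: T|%SET = k) => [|]; first by move: dE; lia.
  rewrite -[RHS]card_ord -(card_codom sinj).
  by apply: eq_card => l; rewrite !inE negbK.
(* P has degree q and vanishes at every node not selected by s, except the
   i-th. *)
pose rs := [seq x 0 l | l in (T :\ i)%SET].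
pose P := \prod_(r <- rs) ('X - r%:P).
have rootE l : root P (x 0 l) = (l \in (T :\ i)%SET).
  by rewrite root_prod_XsubC fintype.mem_image.
have sP : (size P <= q.+1)%N.
  rewrite size_prod_XsubC size_image; have := cardsD1 i T.
  by rewrite cardT inE iNs; lia.
have := sum_horner_nodes ax0 sP.
rewrite (bigD1 i)//= big1 ?addr0 => [/eqP|l li]; last first.
  have [/codomP[j ->]|lNs] := boolP (l \in codom s); first by rewrite asj mul0r.
  have /rootP -> : root P (x 0 l) by rewrite rootE !inE li.
  exact: mulr0.
rewrite mulf_eq0 => /orP[/eqP//|].
by rewrite -[_ == 0]/(root P (x 0 i)) rootE !inE eqxx.
Qed.

End MomentSystem.

(** Given the nodes and the amplitudes selected by [s], the moment equations
    have exactly one solution, rational in the data. *)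
Lemma amplitude_solver (R : realType) (d k q : nat) (s : 'I_k -> 'I_d)
    (c : 'rV[R]_q.+1) : d = (k + q.+1)%N -> injective s ->
  exists sol : 'rV[R]_k -> 'rV[R]_d -> 'rV[R]_d,
    (forall w x a, node_space x ->
       a *m node_powers q x = c /\ \row_j a 0 (s j) = w <-> a = sol w x) /\
    (forall n (U : set 'rV[R]_n) (w : 'rV[R]_n -> 'rV[R]_k)
        (x : 'rV[R]_n -> 'rV[R]_d),
       (forall j, rational_on U (fun p => w p 0 j)) ->
       (forall i, rational_on U (fun p => x p 0 i)) ->
       (forall p, U p -> node_space (x p)) ->
       forall i, rational_on U (fun p => sol (w p) (x p) 0 i)).
Proof.
move=> dE sinj; subst d.
(* Cramer's rule; with the adjugate in place of the inverse matrix, the formula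
   is a rational expression on the whole space. *)
pose M (x : 'rV[R]_(k + q.+1)) := system_mx q s x.
have detM x : node_space x -> \det (M x) != 0.
  move=> xn; rewrite -unitfE -[_ \is a _]/(M x \in unitmx) -row_free_unit.
  by apply: inj_row_free => a; exact: system_inj.
exists (fun w x => (\det (M x))^-1 *: (row_mx w c *m \adj (M x))); split.
  move=> w x a xn; split=> [[ax aw]|->].
    have <- : a *m M x = row_mx w c by rewrite mul_system_mx ax aw.
    by rewrite -mulmxA mul_mx_adj mul_mx_scalar scalerA mulVf ?scale1r ?detM.
  suff: (\det (M x))^-1 *: (row_mx w c *m \adj (M x)) *m M x = row_mx w c.
    by rewrite {3}/M mul_system_mx => /eq_row_mx[-> ->].
  rewrite -scalemxAl -mulmxA mul_adj_mx mul_mx_scalar scalerA.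
  by rewrite mulVf ?scale1r ?detM.
move=> n U w x ratw ratx xn i.
have ratM i' j : rational_on U (fun p => M (x p) i' j).
  under eq_fun do rewrite mxE; case: (fintype.split j) => j'.
    by under eq_fun do rewrite mxE; exact: rational_cst.
  by under eq_fun do rewrite mxE; exact: rational_exp.
under eq_fun do rewrite !mxE.
apply: rational_mul.
  by apply: rational_inv; [exact: rational_det|move=> p Up; apply/detM/xn].
apply: rational_sum => l; apply: rational_mul; last exact: rational_adj.
under eq_fun do rewrite mxE; case: (fintype.split l) => l'; first exact: ratw.
exact: rational_cst.
Qed.

Lemma last_amp_inj d q : injective (@last_amp d q).
Proof. by move=> i j /(congr1 val) /= ij; apply: val_inj => /=; lia. Qed.

Lemma rank_node_powers (R : realType) d q (x : 'rV[R]_d) :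
  (q < d)%N -> node_space x -> \rank (node_powers q x) = q.+1.
Proof.
move=> qd xn; apply/eqP; rewrite -[_ == _]/(row_full _) -sub1mx.
apply/row_subP => l.
have dE : d = (d - q - 1 + q.+1)%N by lia.
have [sol [solP _]] :=
  amplitude_solver (row l (1%:M : 'M[R]_q.+1)) dE (@last_amp_inj d q).
have [<- _] := (solP 0 x (sol 0 x) xn).2 erefl.
exact: submxMl.
Qed.

(** * Regularity of the moment equations and fibers *)

Lemma rational_select_amps (R : realType) d k (s : 'I_k -> 'I_d)
    (U : set 'rV[R]_(d + d)) j :
  rational_on U (fun p => select_amps s p 0 j).
Proof. by under eq_fun do rewrite mxE; exact: rational_lsubmx. Qed.

Lemma rational_moment_map (R : realType) d q (U : set 'rV[R]_(d + d)) l :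
  rational_on U (fun p => moment_map q p 0 l).
Proof.
under eq_fun do rewrite mxE; apply: rational_sum => j.
apply: rational_mul; first exact: rational_lsubmx.
by apply: rational_exp; exact: rational_rsubmx.
Qed.

(** The moment map is affine in the amplitudes, so along them its difference
    quotients are constant. *)
Lemma derive_moment_map_amps (R : realType) d q (p : 'rV[R]_(d + d))
    (a : 'rV[R]_d) :
  'D_(row_mx a 0) (moment_map q) p = a *m node_powers q (nodes p).
Proof.
apply/cvg_lim => //; apply: cvg_near_cst; near=> h.
rewrite /shift /= !moment_mapE /amps /nodes.
have -> : lsubmx (h *: row_mx a 0 + p) = h *: a + lsubmx p.
  by rewrite linearD linearZ /= row_mxKl.
have -> : rsubmx (h *: row_mx a 0 + p) = rsubmx p.
  by rewrite linearD linearZ /= row_mxKr scaler0 add0r.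
rewrite mulmxDl addrK -scalemxAl scalerA mulVf ?scale1r//.
by near: h; exact: nbhs_dnbhs_neq.
Unshelve. all: by end_near. Qed.

(** The upper block of the transposed Jacobian is the matrix of node powers. *)
Lemma moment_map_regular (R : realType) d q (p : 'rV[R]_(d + d)) :
  (q < d)%N -> node_space (nodes p) -> regular_at (@moment_map R d q) p.
Proof.
move=> qd pn.
have dF : differentiable (@moment_map R d q) p.
  apply: differentiable_rational => l; exact: rational_moment_map.
split => //; apply/eqP; rewrite eqn_leq rank_leq_col/=.
rewrite -{1}(rank_node_powers qd pn); apply/mxrankS/row_subP => i.
rewrite rowE -derive_moment_map_amps deriveEjacobian//; exact: submxMl.
Qed.

Lemma fiber_affine_subspace (R : realType) d q (c : 'rV[R]_q.+1)
    (x : 'rV[R]_d) : (q < d)%N -> node_space x ->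
  affine_subspace (d - q - 1)
    (fiber [set p | node_space (nodes p) /\ moment_map q p = c] x).
Proof.
move=> qd xn; have full : row_full (node_powers q x).
  by rewrite /row_full rank_node_powers.
have [B BV] := row_fullP full.
exists (c *m B), (kermx (node_powers q x)); split.
  by rewrite mxrank_ker rank_node_powers// -subnDA addn1.
apply/seteqP; split=> a /=; rewrite /fiber /= moment_mapE /amps /nodes.
  rewrite row_mxKl row_mxKr => -[_ ac]; apply/sub_kermxP.
  by rewrite mulmxBl ac -mulmxA BV mulmx1 subrr.
move=> /sub_kermxP/eqP; rewrite row_mxKl row_mxKr mulmxBl -mulmxA BV mulmx1.
by rewrite subr_eq0 => /eqP.
Qed.

(** * Global charts and contractibility *)

Lemma open_nodes (R : realType) n d (x : 'rV[R]_n -> 'rV[R]_d) :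
  continuous x -> open [set y | node_space (x y)].
Proof.
move=> cx; rewrite openE => y yn.
have near_ij (i j : 'I_d) :
    \forall z \near y, (i < j)%N -> x z 0 i < x z 0 j.
  have [ij|ij] := boolP (i < j)%N; last by near=> z.
  have cxi l : {for y, continuous (fun z => x z 0 l)}.
    exact: (@continuous_comp _ _ _ x (fun u : 'rV[R]_d => u 0 l) y (cx y)
      (@coord_continuous _ _ _ 0 l (x y))).
  have xij : 0 < x y 0 j - x y 0 i by rewrite subr_gt0 yn.
  have cB : (fun z => x z 0 j - x z 0 i) @ y --> x y 0 j - x y 0 i.
    exact: (cvgB (cxi j) (cxi i)).
  have near_gt0 := cvgr_gt _ cB _ xij.
  by near=> z => _; rewrite -subr_gt0; near: z; exact: near_gt0.
have near_all : \forall z \near y, forall i j : 'I_d,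
    (i < j)%N -> x z 0 i < x z 0 j.
  have row_near i := @filter_forall _ _ _ _ (nbhs_filter y) (near_ij i).
  exact: (@filter_forall _ _ _ _ (nbhs_filter y) row_near).
exact: near_all.
Unshelve. all: by end_near. Qed.

Lemma node_space_conv (R : realType) d (t : R) (x y : 'rV[R]_d) :
  0 <= t <= 1 -> node_space x -> node_space y ->
  node_space ((1 - t) *: x + t *: y).
Proof.
move=> /andP[t0 t1] xn yn i j ij; rewrite !mxE.
have [->|t_neq1] := eqVneq t 1; first by rewrite subrr !mul0r !add0r !mul1r yn.
apply: ltr_leD; last by rewrite ler_wpM2l// ltW// yn.
by rewrite ltr_pM2l ?xn// subr_gt0 lt_neqAle t_neq1.
Qed.

(** The straight-line homotopy in the convex set [Y], transported to [X]. *)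
Lemma contractible_convex_chart (R : realType) n m (X : set 'rV[R]_n)
    (Y : set 'rV[R]_m) (f : 'rV[R]_n -> 'rV[R]_m) (g : 'rV[R]_m -> 'rV[R]_n) :
  X !=set0 -> continuous f -> set_fun X Y f -> set_fun Y X g ->
  (forall p, X p -> g (f p) = p) ->
  (forall y, Y y -> {for y, continuous g}) ->
  (forall (t : R) y z, 0 <= t <= 1 -> Y y -> Y z ->
     Y ((1 - t) *: y + t *: z)) ->
  contractible X.
Proof.
move=> [c Xc] cf fXY gYX gfK cg convY.
pose h (tp : R * 'rV[R]_n) := (1 - tp.1) *: f tp.2 + tp.1 *: f c.
have Yh (tp : R * 'rV[R]_n) : (`[0, 1] `*` X) tp -> Y (h tp).
  case: tp => t p [/= t01 Xp]; apply: convY; try exact: fXY.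
  by move: t01; rewrite in_itv.
exists c, (g \o h); split => //.
- apply: continuous_in_subspaceT => tp; rewrite inE => Xtp.
  apply: continuous_comp; last exact/cg/Yh.
  apply: cvgD; apply: cvgZ.
  + by apply: cvgB; [exact: cvg_cst|exact: cvg_fst].
  + by apply: continuous_comp; [exact: cvg_snd|exact: cf].
  + exact: cvg_fst.
  + exact: cvg_cst.
- by move=> tp Xtp; exact/gYX/Yh.
- by move=> p Xp; rewrite /h /= subr0 scale1r scale0r addr0 gfK.
- by move=> p Xp; rewrite /h /= subrr scale1r scale0r add0r gfK.
Qed.

Section Charts.
Variables (R : realType) (d k q : nat) (s : 'I_k -> 'I_d) (c : 'rV[R]_q.+1).
Hypotheses (dE : d = (k + q.+1)%N) (sinj : injective s).

Let S : set 'rV[R]_(d + d) :=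
  [set p | node_space (nodes p) /\ moment_map q p = c].

(** The space R^m stands for the product of the spaces of nodes and of selected
    amplitudes, with projections [x] and [w]; keeping it abstract covers both
    orders of the two blocks. Besides the diffeomorphism, the global inverse is
    provided, with its continuity at the points of [Y]. *)
Lemma variety_chart m (x : 'rV[R]_m -> 'rV[R]_d) (w : 'rV[R]_m -> 'rV[R]_k)
    (f : 'rV[R]_(d + d) -> 'rV[R]_m) :
  (forall U i, rational_on U (fun y => x y 0 i)) ->
  (forall U j, rational_on U (fun y => w y 0 j)) ->
  (forall U l, rational_on U (fun p => f p 0 l)) ->
  (forall p, x (f p) = nodes p) -> (forall p, w (f p) = select_amps s p) ->
  (forall y y', x y = x y' -> w y = w y' -> y = y') ->
  let Y := [set y | node_space (x y)] in
  diffeomorphism S Y f /\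
  exists g, [/\ set_fun Y S g, forall p, S p -> g (f p) = p
    & forall y, Y y -> {for y, continuous g}].
Proof.
move=> ratx ratw ratf xf wf xw_inj Y.
have [sol [solP rat_sol]] := amplitude_solver c dE sinj.
have openY : open Y.
  apply: open_nodes => y; apply: differentiable_continuous.
  by apply: differentiable_rational.
pose g y := row_mx (sol (w y) (x y)) (x y).
have ratg l : rational_on Y (fun y => g y 0 l).
  rewrite /g; under eq_fun do rewrite mxE.
  by case: (fintype.split l) => i; [exact: rat_sol|exact: ratx].
have gS : set_fun Y S g.
  move=> y Yy; rewrite /S /= moment_mapE /amps /nodes /g row_mxKl row_mxKr.
  split=> //.
  by have [_ /(_ erefl)[]] := solP (w y) (x y) (sol (w y) (x y)) Yy.
have gK p : S p -> g (f p) = p.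
  move=> [pn pc]; rewrite /g xf wf.
  rewrite -[RHS]hsubmxK; congr row_mx; apply/esym/solP => //.
  by rewrite -moment_mapE.
have fK y : Y y -> f (g y) = y.
  move=> Yy; apply: xw_inj; rewrite ?xf ?wf ?/nodes ?row_mxKr//.
  have [_ /(_ erefl)[_ wE]] := solP (w y) (x y) (sol (w y) (x y)) Yy.
  by rewrite /select_amps /amps row_mxKl.
have fY : set_fun S Y f by move=> p [pn _]; rewrite /Y /= xf.
split; last first.
  exists g; split => // y Yy; apply: differentiable_continuous.
  apply: differentiable_row => j.
  exact: rational_differentiable (ratg j) y Yy.
split.
- split => // [p p' /set_mem Sp /set_mem Sp' ffE|y Yy].
    by rewrite -(gK p)// ffE gK.
  by exists (g y); [exact: gS|exact: fK].
- by apply: (@smooth_on_rational _ _ setT) => //; exact: openT.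
- exists g; first by move=> p /set_mem; exact: gK.
  exact: (@smooth_on_rational _ _ Y).
Qed.

End Charts.

(** * The Prony variety *)

(** Only the prescribed moments of order at most q matter. *)
Lemma prony_varietyE (R : realType) d q (mu : 'rV[R]_(2 * d)) :
  (q < d)%N -> exists c : 'rV[R]_q.+1,
    prony_variety q mu = [set p | node_space (nodes p) /\ moment_map q p = c].
Proof.
move=> qd; have q2d : (q.+1 <= 2 * d)%N by lia.
exists (\row_l mu 0 (widen_ord q2d l)).
apply/seteqP; split=> p [pn pmu]; split => //.
  by apply/rowP => l; rewrite !mxE -pmu//= -ltnS.
move=> l; rewrite -ltnS => lq; have /rowP/(_ (Ordinal lq)) := pmu.
by rewrite !mxE => ->; congr (mu 0 _); exact: val_inj.
Qed.

Theorem theorem2p2 (R : realType) (d : nat) (hd : (1 <= d)%N) (q : nat)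
    (hq : (q <= d - 1)%N) (mu : 'rV[R]_(2 * d)) :
  let S := prony_variety q mu in
  [/\ [/\ S !=set0,
          submanifold (2 * d - q - 1) S
        & forall p, S p -> regular_at (@moment_map R d q) p],
      (forall s : 'I_(d - q - 1) -> 'I_d, injective s ->
         global_coordinates s S) /\
      global_coordinates (@last_amp d q) S
    & [/\ @nodes R d @` S = @node_space R d,
          forall x, node_space x -> affine_subspace (d - q - 1) (fiber S x),
          affine_trivialization S
            (fun p => row_mx (select_amps (@last_amp d q) p) (nodes p))
        & contractible S]].
Proof.
have qd : (q < d)%N by lia.
have dE : d = (d - q - 1 + q.+1)%N by lia.
have [c ->] := prony_varietyE mu qd; set S := [set p | _] => /=.
have last_inj := @last_amp_inj d q.
have submx_inj n1 n2 (y y' : 'rV[R]_(n1 + n2)) :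
    lsubmx y = lsubmx y' -> rsubmx y = rsubmx y' -> y = y'.
  by rewrite -{3}(hsubmxK y) -{3}(hsubmxK y') => -> ->.
have rat_nodes_first s U l :
    rational_on U (fun p : 'rV[R]_(d + d) =>
      (row_mx (nodes p) (select_amps (k := d - q - 1) s p)) 0 l).
  apply: rational_row_mx => i; first exact: rational_rsubmx.
  exact: rational_select_amps.
have chart s (sinj : injective s) :=
  variety_chart (f := fun p => row_mx (nodes p) (select_amps s p))
    c dE sinj (@rational_lsubmx R d (d - q - 1))
    (@rational_rsubmx R d (d - q - 1)) (rat_nodes_first s)
    (fun p => row_mxKl _ _) (fun p => row_mxKr _ _) (@submx_inj _ _).
have trivial_chart : diffeomorphism S
    [set y : 'rV[R]_(d - q - 1 + d) | node_space (rsubmx y)]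
    (fun p => row_mx (select_amps (@last_amp d q) p) (nodes p)).
  apply: (variety_chart c dE last_inj
    (@rational_rsubmx R (d - q - 1) d) (@rational_lsubmx R (d - q - 1) d) _
    (fun p => row_mxKr _ _) (fun p => row_mxKl _ _) _).1.
  - move=> U l; apply: rational_row_mx => i; first exact: rational_select_amps.
    exact: rational_rsubmx.
  - by move=> y y' yr yl; exact: submx_inj.
have [coords [g [gS gK g_cont]]] := chart _ last_inj.
have nodes_onto x : node_space x -> exists2 p, S p & nodes p = x.
  move=> xn; have [[_ _ surj] _ _] := trivial_chart.
  have [|p Sp /(congr1 rsubmx)] := surj (row_mx 0 x).
    by rewrite /= row_mxKr.
  by rewrite !row_mxKr => px; exists p.
have S_neq0 : S !=set0.
  (* The integers 0, ..., d-1 are admissible nodes. *)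
  have [|p Sp _] := nodes_onto (\row_i i%:R); last by exists p.
  by move=> i j ij; rewrite !mxE ltr_nat.
split.
- split => //; last by move=> p [pn _]; exact: moment_map_regular.
  rewrite (_ : (2 * d - q - 1)%N = (d + (d - q - 1))%N); last by lia.
  move=> p Sp; exists setT, [set y | node_space (lsubmx y)],
    (fun p => row_mx (nodes p) (select_amps (@last_amp d q) p)).
  split => //; first exact: openT.
    by apply: open_nodes; exact: continuous_lsubmx.
  by rewrite setIT.
- by split=> // s sinj; exact: (chart s sinj).1.
- split.
  + apply/seteqP; split=> [_ [p [pn _] <-]//|x xn].
    by have [p Sp px] := nodes_onto x xn; exists p.
  + by move=> x; exact: fiber_affine_subspace.
  + split => //.
      by move=> p _; rewrite row_mxKr.
    move=> x xn a b _ _ t; rewrite !row_mxKl /select_amps /amps !row_mxKl.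
    by apply/rowP => j; rewrite !mxE.
  + apply: (contractible_convex_chart S_neq0 _ _ gS gK g_cont).
    * move=> p; apply: differentiable_continuous.
      by apply: differentiable_rational; exact: rat_nodes_first.
    * by have [[]] := coords.
    * move=> t y z t01 yn zn /=; rewrite linearD /= !linearZ /=.
      exact: node_space_conv.
Qed.
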